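(* Let $r\ge3$ be an integer and for integers $n$ let $P_n=\dfrac{n\left(n(r-2)-(r-4)\right)}{2}$ (the $r$-gonal numbers). For integers $n\ge1$ and $k\ge1$, the triangle with vertices $(P_n,P_{n+k})$, $(P_{n+2k},P_{n+3k})$, $(P_{n+4k},P_{n+5k})$ has area $4(r-2)^2k^4$.
   Context: The area of the triangle with vertices $(x_1,y_1),(x_2,y_2),(x_3,y_3)$ is $\frac12\left|(x_2-x_1)(y_3-y_1)-(x_3-x_1)(y_2-y_1)\right|$. *)

(* Defs.v *)
From mathcomp Require Import all_boot all_order all_algebra.

Set Implicit Arguments.
Unset Strict Implicit.
Unset Printing Implicit Defensive.

Import Order.TTheory GRing.Theory Num.Theory.
Local Open Scope ring_scope.

(* The division is that of the field [R]; the numerator is an even integer, so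
   the value is an integer of [R]. The index [n] ranges over all of Z. *)
Definition polygonal (R : realFieldType) (r n : int) : R :=
  (n * (n * (r - 2) - (r - 4)))%:~R / 2.

(* Shoelace formula: a triangle is given by its vertices in the plane R^2. *)
Definition triangle_area (R : realFieldType) (A B C : R * R) : R :=
  `|(B.1 - A.1) * (C.2 - A.2) - (C.1 - A.1) * (B.2 - A.2)| / 2.

(* Main.v *)
Require Import Defs.
From mathcomp Require Import all_boot all_order all_algebra.
From mathcomp Require Import ring.

Import Order.TTheory GRing.Theory Num.Theory.
Local Open Scope ring_scope.

Theorem theorem4p1 (R : realFieldType) (r : int) (hr : 3 <= r)
    (n k : int) (hn : 1 <= n) (hk : 1 <= k) :
  triangle_area
    (polygonal R r n, polygonal R r (n + k))
    (polygonal R r (n + 2 * k), polygonal R r (n + 3 * k))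
    (polygonal R r (n + 4 * k), polygonal R r (n + 5 * k))
  = 4 * (r%:~R - 2) ^+ 2 * k%:~R ^+ 4.
Proof.
rewrite /triangle_area /polygonal /=.
set det := (X in `|X|).
(* Put [w = (r-2)k^2/2] and [u = P_(n+2k) - P_n - 4w]. The coordinate differences in [det] are
   [u+4w], [2u+24w], [2u+16w], [u+8w]; the [u^2] and [uw] terms cancel, leaving [-32w^2], free of
   [n]. *)
have -> : det = - (8 * ((r%:~R - 2) * k%:~R ^+ 2) ^+ 2) by rewrite /det; field.
(* Keeping the square unexpanded makes the sign visible: the absolute value only removes the minus,
   and halving 8 gives the factor 4. *)
rewrite normrN ger0_norm; first by field.
by rewrite mulr_ge0 ?sqr_ge0 ?ler0n.
Qed.
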